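(* Let $w_1,w_2,w_3$ be positive integers and $n\ge0$ an integer. Then \begin{align*} &\sum_{k+l+m=n}\binom{n}{k,l,m}S_{k,q^{w_3}}(w_1-1)S_{l,q^{w_1}}(w_2-1)S_{m,q^{w_2}}(w_3-1)\,w_3^{k-1}w_1^{l-1}w_2^{m-1}\\ &=\sum_{k+l+m=n}\binom{n}{k,l,m}S_{k,q^{w_2}}(w_1-1)S_{l,q^{w_1}}(w_3-1)S_{m,q^{w_3}}(w_2-1)\,w_2^{k-1}w_1^{l-1}w_3^{m-1}. \end{align*}
   Context: Let $p$ be a prime, $\mathbb{C}_p$ the completion of an algebraic closure of $\mathbb{Q}_p$, and $|\cdot|_p$ the absolute value on $\mathbb{C}_p$ with $|p|_p=1/p$. Fix $q\in\mathbb{C}_p$ with $q\neq 1$ and $|q-1|_p<p^{-1/(p-1)}$. For $Q\in\mathbb{C}_p$ and integers $k\ge0$, $N\ge0$, the $Q$-analogue of the power sum is $S_{k,Q}(N)=\sum_{i=0}^N i^kQ^i$, with the convention $0^0=1$. The sum $\sum_{k+l+m=n}$ runs over nonnegative integers $k,l,m$ with $k+l+m=n$, and $\binom{n}{k,l,m}=\frac{n!}{k!\,l!\,m!}$. *)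

(* Defs.v *)
From HB Require Import structures.
From mathcomp Require Import all_boot all_order all_algebra.
From mathcomp Require Import all_classical all_reals all_analysis.
Set Implicit Arguments.
Unset Strict Implicit.
Unset Printing Implicit Defensive.
Import Order.TTheory GRing.Theory Num.Theory.
Local Open Scope ring_scope.

Record ultrametric_absval (R : realType) (K : fieldType) (v : K -> R) : Prop := {
  absval_ge0 : forall x, 0 <= v x;
  absval_eq0 : forall x, v x = 0 <-> x = 0;
  absvalM : forall x y, v (x * y) = v x * v y;
  absvalD : forall x y, v (x + y) <= Num.max (v x) (v y)
}.

Definition absval_complete (R : realType) (K : fieldType) (v : K -> R) : Prop :=
  forall u : nat -> K,
    (forall e : R, 0 < e -> exists N : nat, forall m n : nat,
       (N <= m)%N -> (N <= n)%N -> v (u m - u n) < e) ->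
    exists l : K, forall e : R, 0 < e -> exists N : nat, forall n : nat,
      (N <= n)%N -> v (u n - l) < e.

Record is_completion (R : realType) (K L : fieldType) (vK : K -> R) (vL : L -> R)
    (iota : {rmorphism K -> L}) : Prop := {
  completion_absval : ultrametric_absval vL;
  completion_isometry : forall x, vL (iota x) = vK x;
  completion_dense : forall (y : L) (e : R), 0 < e -> exists x : K, vL (y - iota x) < e;
  completion_complete : absval_complete vL
}.

Record is_algebraic_closure (K L : fieldType) (iota : {rmorphism K -> L}) : Prop := {
  algebraic_closure_closed : GRing.closed_field_axiom L;
  algebraic_closure_algebraic : forall y : L, algebraicOver iota y
}.

Definition padic_absval (R : realType) (p : nat) (x : rat) : R :=
  if x == 0 then 0
  else p%:R ^+ logn p `|denq x|%N / p%:R ^+ logn p `|numq x|%N.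

(* The libraries have no p-adic numbers.  The valued field of p-adic complex
   numbers is described by its construction, which determines it up to isometric
   isomorphism: Qp is the completion of the rationals for the p-adic absolute
   value, Qpbar is an algebraic closure of Qp with an absolute value extending
   that of Qp (there is only one), and Cp is the completion of Qpbar.  The
   normalization |p| = 1/p is that of [padic_absval]. *)
Definition is_Cp (R : realType) (p : nat) (Cp : fieldType) (v : Cp -> R) : Prop :=
  exists (Qp Qpbar : fieldType) (vQp : Qp -> R) (vQpbar : Qpbar -> R)
         (i0 : {rmorphism rat -> Qp}) (i1 : {rmorphism Qp -> Qpbar})
         (i2 : {rmorphism Qpbar -> Cp}),
    [/\ is_completion (@padic_absval R p) vQp i0,
        is_algebraic_closure i1,
        ultrametric_absval vQpbar,
        (forall x, vQpbar (i1 x) = vQp x) &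
        is_completion vQpbar v i2].

Definition qpowsum (K : fieldType) (k : nat) (Q : K) (N : nat) : K :=
  \sum_(0 <= i < N.+1) i%:R ^+ k * Q ^+ i.

Definition trinomial (K : fieldType) (n k l m : nat) : K :=
  n`!%:R / (k`!%:R * l`!%:R * m`!%:R).

(* Main.v *)
(* Up to the factor [1 / (w1 w2 w3)], expanding the power sums and the trinomial
   theorem turn the left-hand side into the sum of [a^n q^a] over the exponents
   [a = w3 i + w1 j + w2 h] with [i < w1], [j < w2], [h < w3].  This is the value
   at [q] of the [n]-th iterate of the Euler operator [X d/dX] on the polynomial
   ((X^(w1 w3) - 1) (X^(w1 w2) - 1) (X^(w2 w3) - 1))
     / ((X^w3 - 1) (X^w1 - 1) (X^w2 - 1)),
   which is symmetric in the [w_i]. *)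
Require Import Defs.
From HB Require Import structures.
From mathcomp Require Import all_boot all_order all_algebra.
From mathcomp Require Import all_classical all_reals all_analysis.
From mathcomp Require Import ring zify.
Import Order.TTheory GRing.Theory Num.Theory.
Local Open Scope ring_scope.

Lemma is_Cp_natr_neq0 (R : realType) (p : nat) (Cp : fieldType) (v : Cp -> R) :
  is_Cp p v -> forall m : nat, (0 < m)%N -> m%:R != 0 :> Cp.
Proof.
move=> [Qp [Qpbar [_ [_ [i0 [i1 [i2 _]]]]]]] m m_gt0.
have -> : m%:R = i2 (i1 (i0 m%:R)) by rewrite !rmorph_nat.
by rewrite !fmorph_eq0 pnatr_eq0 -lt0n.
Qed.

Section CharacteristicZero.
Variable K : fieldType.
Hypothesis natr_neq0 : forall m : nat, (0 < m)%N -> m%:R != 0 :> K.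

Lemma trinomialE (n k l : nat) : (k + l <= n)%N ->
  trinomial K n k l (n - k - l) = ('C(n, k) * 'C(n - k, l))%:R.
Proof.
move=> kl_le_n.
have k_le_n : (k <= n)%N by apply: leq_trans kl_le_n; exact: leq_addr.
have l_le_nk : (l <= n - k)%N by rewrite leq_subRL.
have fact_neq0 m : m`!%:R != 0 :> K by rewrite natr_neq0 ?fact_gt0.
rewrite /trinomial -(bin_fact k_le_n) -(bin_fact l_le_nk) !natrM.
by field; rewrite !fact_neq0.
Qed.

Lemma exprD3n (x y z : K) (n : nat) :
  \sum_(k < n.+1) \sum_(l < n.+1) \sum_(m < n.+1 | (k + l + m == n)%N)
     trinomial K n k l m * (x ^+ k * y ^+ l * z ^+ m) = (x + y + z) ^+ n.
Proof.
rewrite -addrA addrC exprDn; apply: eq_bigr => k _.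
have k_le_n : (k <= n)%N by rewrite -ltnS.
rewrite (addrC y) exprDn.
rewrite (big_ord_widen n.+1 (fun l => z ^+ (n - k - l) * y ^+ l *+ 'C(n - k, l)));
  last by rewrite ltnS leq_subr.
rewrite mulr_suml -sumrMnl [RHS]big_mkcond; apply: eq_bigr => l _.
rewrite ltnS leq_subRL //; case: ifPn => [kl_le_n | kl_gt_n].
  have m_lt : (n - k - l < n.+1)%N by rewrite ltnS -subnDA leq_subr.
  rewrite (big_pred1 (Ordinal m_lt)) => [|m] /=.
    by rewrite trinomialE // natrM; ring.
  by rewrite -val_eqE /=; lia.
by rewrite big_pred0 // => m; apply/eqP; lia.
Qed.

Lemma expr_int_pred (x : K) (k : nat) : x != 0 -> x ^ (k%:Z - 1) = x ^+ k / x.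
Proof. by move=> x_neq0; exact: expfzDr. Qed.

Definition euler_iter (n : nat) (P : {poly K}) : {poly K} :=
  iter n (fun P => 'X * P^`()) P.

Lemma euler_iter_sum (n : nat) (I : finType) (F : I -> {poly K}) :
  euler_iter n (\sum_i F i) = \sum_i euler_iter n (F i).
Proof. by elim: n => //= n ->; rewrite raddf_sum mulr_sumr. Qed.

Lemma euler_iterXn (n a : nat) : euler_iter n 'X^a = a%:R ^+ n *: 'X^a.
Proof.
elim: n => [|n /= ->]; first by rewrite scale1r.
rewrite derivZ derivXn -scalerAr exprSr -scalerA; congr (_ *: _).
case: a => [|a]; first by rewrite mulr0n mulr0 scale0r.
by rewrite mulrnAr -exprS scaler_nat.
Qed.

Definition geom (w a : nat) : {poly K} := \sum_(i < w) 'X^(a * i).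

Lemma geom_mul (w a : nat) : ('X^a - 1) * geom w a = 'X^(a * w) - 1.
Proof.
rewrite exprM [RHS]subrX1 /geom; congr (_ * _); apply: eq_bigr => i _.
by rewrite exprM.
Qed.

Lemma geom_prod_sym (w1 w2 w3 : nat) :
  (0 < w1)%N -> (0 < w2)%N -> (0 < w3)%N ->
  geom w1 w3 * geom w2 w1 * geom w3 w2 = geom w1 w2 * geom w3 w1 * geom w2 w3.
Proof.
move=> w1_gt0 w2_gt0 w3_gt0.
have Xn1_neq0 w : (0 < w)%N -> 'X^w - 1 != 0 :> {poly K}.
  by move=> w_gt0; rewrite -size_poly_eq0 size_XnsubC.
apply: (mulfI (mulf_neq0 (mulf_neq0 (Xn1_neq0 _ w1_gt0) (Xn1_neq0 _ w2_gt0))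
                         (Xn1_neq0 _ w3_gt0))).
transitivity ((('X^w3 - 1) * geom w1 w3) * (('X^w1 - 1) * geom w2 w1)
              * (('X^w2 - 1) * geom w3 w2)); first by ring.
transitivity ((('X^w2 - 1) * geom w1 w2) * (('X^w1 - 1) * geom w3 w1)
              * (('X^w3 - 1) * geom w2 w3)); last by ring.
by rewrite !geom_mul (mulnC w3 w1) (mulnC w2 w1) (mulnC w3 w2); ring.
Qed.

Lemma sum_trinomial_qpowsum (q : K) (a b c x y z n : nat) :
  (0 < a)%N -> (0 < b)%N -> (0 < c)%N -> (0 < x)%N -> (0 < y)%N -> (0 < z)%N ->
  \sum_(k < n.+1) \sum_(l < n.+1) \sum_(m < n.+1 | (k + l + m == n)%N)
     trinomial K n k l m
     * qpowsum k (q ^+ x) (a - 1) * qpowsum l (q ^+ y) (b - 1)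
     * qpowsum m (q ^+ z) (c - 1)
     * x%:R ^ (k%:Z - 1) * y%:R ^ (l%:Z - 1) * z%:R ^ (m%:Z - 1)
  = (euler_iter n (geom a x * geom b y * geom c z)).[q] / (x * y * z)%:R.
Proof.
move=> a_gt0 b_gt0 c_gt0 x_gt0 y_gt0 z_gt0.
have qpowsumE k Q w : (0 < w)%N ->
    qpowsum k Q (w - 1) = \sum_(i < w) i%:R ^+ k * Q ^+ i :> K.
  by move=> w_gt0; rewrite /qpowsum subn1 prednK // big_mkord.
have -> : (euler_iter n (geom a x * geom b y * geom c z)).[q] =
    \sum_(i < a) \sum_(j < b) \sum_(h < c)
      (x * i + y * j + z * h)%:R ^+ n * q ^+ (x * i + y * j + z * h).
  rewrite /geom -mulrA mulr_suml euler_iter_sum horner_sum; apply: eq_bigr => i _.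
  rewrite mulr_suml mulr_sumr euler_iter_sum horner_sum; apply: eq_bigr => j _.
  rewrite !mulr_sumr euler_iter_sum horner_sum; apply: eq_bigr => h _.
  by rewrite -!exprD addnA euler_iterXn hornerZ hornerXn.
transitivity (\sum_(i < a) \sum_(j < b) \sum_(h < c)
    \sum_(k < n.+1) \sum_(l < n.+1) \sum_(m < n.+1 | (k + l + m == n)%N)
    trinomial K n k l m
      * ((x * i)%:R ^+ k * (y * j)%:R ^+ l * (z * h)%:R ^+ m)
      * (q ^+ (x * i + y * j + z * h) / (x * y * z)%:R)); last first.
  rewrite mulr_suml; apply: eq_bigr => i _.
  rewrite mulr_suml; apply: eq_bigr => j _.
  rewrite mulr_suml; apply: eq_bigr => h _.
  rewrite -[RHS]mulrA !natrD -exprD3n !mulr_suml; apply: eq_bigr => k _.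
  by rewrite mulr_suml; apply: eq_bigr => l _; rewrite mulr_suml.
transitivity (\sum_(k < n.+1) \sum_(l < n.+1)
    \sum_(m < n.+1 | (k + l + m == n)%N)
    \sum_(i < a) \sum_(j < b) \sum_(h < c)
    trinomial K n k l m
      * ((x * i)%:R ^+ k * (y * j)%:R ^+ l * (z * h)%:R ^+ m)
      * (q ^+ (x * i + y * j + z * h) / (x * y * z)%:R)).
  apply: eq_bigr => k _; apply: eq_bigr => l _; apply: eq_bigr => m _.
  rewrite !qpowsumE // !expr_int_pred ?natr_neq0 //.
  rewrite [_ * \sum_(_ < a) _]mulr_sumr !mulr_suml; apply: eq_bigr => i _.
  rewrite [_ * \sum_(_ < b) _]mulr_sumr !mulr_suml; apply: eq_bigr => j _.
  rewrite [_ * \sum_(_ < c) _]mulr_sumr !mulr_suml; apply: eq_bigr => h _.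
  rewrite !natrM !exprMn !exprD !exprM !invfM.
  by ring.
symmetry; rewrite pair_bigA pair_bigA exchange_big; apply: eq_bigr => k _.
rewrite exchange_big; apply: eq_bigr => l _.
rewrite exchange_big; apply: eq_bigr => m _.
by rewrite pair_bigA pair_bigA.
Qed.

End CharacteristicZero.

Theorem theorem4p17 (R : realType) (p : nat) (p_prime : prime p)
    (Cp : fieldType) (abs : Cp -> R) (HCp : is_Cp p abs)
    (q : Cp) (q_neq1 : q <> 1)
    (q_near1 : abs (q - 1) < p%:R `^ (- 1 / (p%:R - 1)))
    (w1 w2 w3 : nat) (w1_gt0 : (0 < w1)%N) (w2_gt0 : (0 < w2)%N) (w3_gt0 : (0 < w3)%N)
    (n : nat) :
  \sum_(k < n.+1) \sum_(l < n.+1) \sum_(m < n.+1 | (k + l + m == n)%N)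
     trinomial Cp n k l m
     * qpowsum k (q ^+ w3) (w1 - 1) * qpowsum l (q ^+ w1) (w2 - 1)
     * qpowsum m (q ^+ w2) (w3 - 1)
     * w3%:R ^ (k%:Z - 1) * w1%:R ^ (l%:Z - 1) * w2%:R ^ (m%:Z - 1)
  = \sum_(k < n.+1) \sum_(l < n.+1) \sum_(m < n.+1 | (k + l + m == n)%N)
     trinomial Cp n k l m
     * qpowsum k (q ^+ w2) (w1 - 1) * qpowsum l (q ^+ w1) (w3 - 1)
     * qpowsum m (q ^+ w3) (w2 - 1)
     * w2%:R ^ (k%:Z - 1) * w1%:R ^ (l%:Z - 1) * w3%:R ^ (m%:Z - 1).
Proof.
have natr_neq0 := is_Cp_natr_neq0 _ _ _ _ HCp.
rewrite !sum_trinomial_qpowsum // geom_prod_sym //.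
by congr (_ / _%:R); rewrite mulnAC (mulnC w3) mulnAC.
Qed.
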